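(* Let $\mathbf{X}=(X,\mathcal{B}_X,\mu,T)$ be a measure-preserving $\mathbb{Z}$-system. The following are equivalent. (1) $\mathbf{X}$ is rigid. (2) For every rate function $U$, there exists a F\o lner sequence $(F_n)$ for $\mathbb{N}$ such that $h_{\mathrm{slow}}^{U,(F_n)}(\mathbf{X})=0$. (3) For the rate function $L(n)=\log n$, there exists a F\o lner sequence $(F_n)$ for $\mathbb{N}$ such that $h_{\mathrm{slow}}^{L,(F_n)}(\mathbf{X})=0$.
   Context: $\mathbf{X}$ consists of a standard probability space $(X,\mathcal{B}_X,\mu)$ and an invertible measure-preserving transformation $T$. $\mathbf{X}$ is rigid if there is a sequence $0=n_0<n_1<n_2<\cdots$ with $\lim_{k\to\infty}\mu(T^{-n_k}A\,\triangle\,A)=0$ for all measurable $A\subseteq X$. A F\o lner sequence for $\mathbb{N}=\{0,1,2,\dots\}$ is a sequence of finite nonempty sets $F_n\subseteq\mathbb{N}$ with $|(F_n+k)\cap F_n|/|F_n|\to1$ for every $k\in\mathbb{N}$ (so $|F_n|\to\infty$, and only the values of rate functions at large integers matter). A rate function is an increasing function $U:\mathbb{N}\to(0,\infty)$ with $U(n)\to\infty$. All partitions are finite and measurable; for $P=\{P_0,\dots,P_{r-1}\}$, $P(x)$ is the index $i$ with $x\in P_i$. For finite $F\subseteq\mathbb{N}$, $d_{P,F}(x,x')=\frac1{|F|}\sum_{f\in F}1_{P(T^fx)\ne P(T^fx')}$, with corresponding diameter $\operatorname{diam}_{P,F}$. For $\epsilon>0$, $\operatorname{cov}(\mu,P,F,\epsilon)$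 is the smallest $M$ such that there exist $E_1,\dots,E_M\subseteq X$ with $\operatorname{diam}_{P,F}(E_i)\le\epsilon$ for all $i$ and $\mu(\bigcup E_i)\ge1-\epsilon$. The slow entropy is $$h_{\mathrm{slow}}^{U,(F_n)}(\mathbf{X},P)=\sup_{\epsilon>0}\limsup_{n\to\infty}\frac{\operatorname{cov}(\mu,P,F_n,\epsilon)}{U(|F_n|)},\qquad h_{\mathrm{slow}}^{U,(F_n)}(\mathbf{X})=\sup_P h_{\mathrm{slow}}^{U,(F_n)}(\mathbf{X},P),$$ the last supremum being over all partitions $P$ of $X$. *)

(* Defs.v *)
From HB Require Import structures.
From mathcomp Require Import all_boot all_order all_algebra finmap.
From mathcomp Require Import all_classical all_reals all_analysis.

Set Implicit Arguments.
Unset Strict Implicit.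
Unset Printing Implicit Defensive.

Import Order.TTheory GRing.Theory Num.Theory.
Import numFieldNormedType.Exports.

Local Open Scope classical_set_scope.
Local Open Scope ring_scope.

Section Spaces.
Context {R : realType}.

Definition borel {Y : metricType R} : set (set Y) :=
  <<s [set U : set Y | open U] >>.

Definition complete_metric (Y : metricType R) : Prop :=
  forall F : set_system Y, ProperFilter F -> cauchy F -> exists y : Y, F --> y.

Definition separable (Y : metricType R) : Prop :=
  exists D : set Y, countable D /\ dense D.

(* X is identified through f with a complete separable metric space Y.  The
   sigma-algebra of X contains the Borel sets of Y and is contained in their
   mu-completion: both usual conventions (a standard Borel space with a Borel
   probability measure, and the completion of such a space) are covered. *)
Definition standard_probability_space d (X : measurableType d)
    (mu : probability X R) : Prop :=
  exists (Y : metricType R) (f : X -> Y),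
    [/\ bijective f, complete_metric Y, separable Y,
        forall B, borel B -> measurable (f @^-1` B) &
        forall A, measurable A -> exists B N,
          [/\ borel B, borel N, mu (f @^-1` N) = 0%E &
              A `+` (f @^-1` B) `<=` f @^-1` N]].

End Spaces.

Section Dynamics.
Context {R : realType} {d : measure_display} {X : measurableType d}.
Variables (mu : probability X R) (T : X -> X).

Definition invertible_measure_preserving : Prop :=
  [/\ bijective T,
      forall A, measurable A -> measurable (T @^-1` A),
      forall A, measurable A -> measurable (T @` A) &
      forall A, measurable A -> mu (T @^-1` A) = mu A].

Definition rigid : Prop :=
  exists n : nat -> nat,
    [/\ n 0%N = 0%N,
        forall k, (n k < n k.+1)%N &
        forall A, measurable A ->
          mu ((iter (n k) T @^-1` A) `+` A) @[k --> \oo] --> 0%E].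

(* A partition {P_0, ..., P_(r-1)} is given by its label map x |-> P(x); the
   cell P_i is the fibre of P over i. *)
Definition measurable_partition (r : nat) (P : X -> 'I_r) : Prop :=
  forall i, measurable (P @^-1` [set i]).

Definition hamming (r : nat) (P : X -> 'I_r) (F : {fset nat}) (x y : X) : R :=
  (\sum_(f <- F) (P (iter f T x) != P (iter f T y))%:R) / #|` F|%:R.

(* sup set0 = 0, so the empty set has diameter 0. *)
Definition diam (r : nat) (P : X -> 'I_r) (F : {fset nat}) (E : set X) : R :=
  sup [set hamming P F x y | x in E & y in E].

Definition coverable (r : nat) (P : X -> 'I_r) (F : {fset nat}) (eps : R)
    (M : nat) : Prop :=
  exists E : 'I_M -> set X,
    [/\ forall i, diam P F (E i) <= eps,
        measurable (\bigcup_i E i) &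
        ((1 - eps)%:E <= mu (\bigcup_i E i))%E].

(* The infimum of a set of natural numbers, hence its least element when the
   set is nonempty. *)
Definition cov (r : nat) (P : X -> 'I_r) (F : {fset nat}) (eps : R) : \bar R :=
  ereal_inf [set (M%:R)%:E | M in coverable P F eps].

Definition slow_entropy_partition (U : nat -> R) (F : nat -> {fset nat})
    (r : nat) (P : X -> 'I_r) : \bar R :=
  ereal_sup
    [set limn_esup (fun n => cov P (F n) eps / (U #|` F n|)%:E)%E
       | eps in [set e : R | 0 < e]].

Definition slow_entropy (U : nat -> R) (F : nat -> {fset nat}) : \bar R :=
  ereal_sup
    [set h | exists (r : nat) (P : X -> 'I_r),
       measurable_partition P /\ h = slow_entropy_partition U F P].

End Dynamics.

Section Rates.
Context {R : realType}.

Definition folner (F : nat -> {fset nat}) : Prop :=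
  (forall n, F n != fset0) /\
  forall k : nat,
    (#|` [fset (x + k)%N | x in F n] `&` F n|%fset%:R / #|` F n|%:R : R)
      @[n --> \oo] --> (1 : R).

Definition rate_function (U : nat -> R) : Prop :=
  [/\ forall n, 0 < U n,
      forall m n, (m <= n)%N -> U m <= U n &
      U n @[n --> \oo] --> +oo].

(* log_rate 0 = log_rate 1 = 0 since ln 0 = 0; a Folner sequence satisfies
   #|` F n| > 1 for all large n, so these values do not affect the entropy. *)
Definition log_rate (n : nat) : R := ln n%:R.

End Rates.

Arguments folner R F : clear implicits.
Arguments log_rate R n : clear implicits.

(* Main.v *)
Require Import Defs.
From mathcomp Require Import all_boot all_order all_algebra finmap.
From mathcomp Require Import all_classical all_reals all_analysis.
From mathcomp Require Import measurable_realfun ring lra zify.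

(** Rigidity produces sets [F] that are long compared with the number of names
    they carry.  If [T ^ h] moves a partition [P] very little for each of [M]
    shifts [h], then, for most points, the [P]-name along the union of the [M]
    translates by these [h] of an interval of length [N] is nearly determined
    by the name along the interval itself.  So about [r ^ N] sets cover the
    space, whatever [M] is ([coverable_block]); taking [M] huge makes
    [U (N * M)] exceed this number by any factor, and [N] tending to infinity
    makes the sets a Folner sequence ([folner_block]).  Because the shifts are
    taken ever further along one rigidity sequence, the same Folner sequence
    serves all partitions ([rigid_slow_entropy0]).

    Conversely, suppose that [M] sets of small diameter cover most of the space
    for a partition [P] and that [M] is much smaller than [ln #|F|].  Pick a
    point in each set.  The letters of these [M] points at a time [f] in [F]
    form a column, with only [r ^ M] possible values, at most the square
    root of [#|F|].  On average over [f] in [F], the letter of a point [x] at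
    time [f] is that of the chosen point of the set containing [x], up to a set
    of small measure, so this holds for at least half of the times.  Two such
    times [i < j] with the same column satisfy P(T^i x) = P(T^j x) for most
    [x], that is, [T ^ (j - i)] moves [P] very little; and among so many times
    one finds [i] and [j] as far apart as desired ([coverable_recurrence]).

    Rigidity needs one sequence that works for every measurable set.  The space
    is separable, so its sigma-algebra is generated, up to null sets, by
    countably many sets [B j].  Recurrence for the partition generated by
    [B 0], ..., [B (k - 1)] gives a sequence that is good for every [B j], and
    the sets for which a given sequence is good form a sigma-algebra
    ([rigid_along_all], [recurrent_rigid]).

    Between these two implications, the logarithm is a rate function after a
    change of its first values, which a Folner sequence does not see since the
    sizes of its sets tend to infinity ([folner_card]). *)

Set Implicit Arguments.
Unset Strict Implicit.
Unset Printing Implicit Defensive.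

Import Order.TTheory GRing.Theory Num.Theory.
Import numFieldNormedType.Exports.

Local Open Scope classical_set_scope.
Local Open Scope ring_scope.

(** * Real-valued volumes and finite-valued maps *)

Section RealMeasure.
Context {R : realType} {d : measure_display} {X : measurableType d}.
Variable mu : probability X R.

Definition vol (A : set X) : R := fine (mu A).

Lemma volE A : measurable A -> mu A = (vol A)%:E.
Proof. by move=> mA; rewrite /vol fineK// fin_num_measure. Qed.

Lemma vol_ge0 A : 0 <= vol A.
Proof. by rewrite /vol fine_ge0. Qed.

Lemma le_vol A B : measurable A -> measurable B -> A `<=` B -> vol A <= vol B.
Proof.
by move=> mA mB AB; rewrite -lee_fin -!volE// le_measure// inE.
Qed.

Lemma vol_setU A B : measurable A -> measurable B ->
  vol (A `|` B) <= vol A + vol B.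
Proof.
move=> mA mB; rewrite -lee_fin EFinD -!volE//; last exact: measurableU.
exact: measureU2.
Qed.

Lemma vol_setC A : measurable A -> vol (~` A) = 1 - vol A.
Proof.
move=> mA; apply/eqP; rewrite -eqe EFinB -!volE//; last exact: measurableC.
by rewrite probability_setC.
Qed.

Lemma vol_bigsetU (I : Type) (s : seq I) (A : I -> set X) :
  (forall i, measurable (A i)) ->
  vol (\big[setU/set0]_(i <- s) A i) <= \sum_(i <- s) vol (A i).
Proof.
move=> mA; elim: s => [|i s IH]; first by rewrite !big_nil /vol measure0.
rewrite !big_cons (le_trans (vol_setU _ _))//; first exact: bigsetU_measurable.
by rewrite lerD2l.
Qed.

Lemma sum_vol_integral (I : Type) (s : seq I) (A : I -> set X) :
  (forall i, measurable (A i)) ->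
  (\int[mu]_x (\sum_(i <- s) \1_(A i) x : R)%:E)%E
    = (\sum_(i <- s) vol (A i))%:E.
Proof.
move=> mA.
have -> : (fun x => (\sum_(i <- s) \1_(A i) x : R)%:E) =
    (fun x => \sum_(i <- s) (\1_(A i) x : R)%:E)%E.
  by apply/funext => x; exact/esym/sumEFin.
rewrite ge0_integral_sum//; last first.
- by move=> i; apply/measurable_EFinP; exact: measurable_indic.
rewrite -sumEFin; apply: eq_bigr => i _.
by rewrite integral_indic// setIT; exact: volE.
Qed.

Lemma measurable_sum_indic (I : Type) (s : seq I) (A : I -> set X) :
  (forall i, measurable (A i)) ->
  measurable_fun setT (fun x => (\sum_(i <- s) \1_(A i) x : R)%:E).
Proof.
move=> mA; apply/measurable_EFinP.
apply: measurable_sum => i.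
exact: measurable_indic.
Qed.

Lemma sum_vol_le (I : Type) (s : seq I) (A : I -> set X) (c : R) :
  (forall i, measurable (A i)) ->
  (forall x, \sum_(i <- s) \1_(A i) x <= c) -> \sum_(i <- s) vol (A i) <= c.
Proof.
move=> mA Ac.
rewrite -lee_fin -sum_vol_integral//.
have -> : c%:E = (\int[mu]_x (cst c%:E) x)%E.
  by rewrite integral_cst//= probability_setT mule1.
apply: ge0_le_integral => //.
- by move=> x _; rewrite lee_fin sumr_ge0.
- exact: measurable_sum_indic.
- by move=> x _; rewrite lee_fin.
Qed.

(** Markov's inequality for the number of sets that contain [x]. *)
Lemma markov_count (I : Type) (s : seq I) (A : I -> set X) (B : set X) (c : R) :
  0 <= c -> measurable B -> (forall i, measurable (A i)) ->
  (forall x, B x -> c <= \sum_(i <- s) \1_(A i) x) ->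
  c * vol B <= \sum_(i <- s) vol (A i).
Proof.
move=> c0 mB mA Bc.
rewrite -lee_fin EFinM -volE// -[X in mu X]setIT -integral_indic//.
rewrite -sum_vol_integral//.
rewrite -ge0_integralZl_EFin//; last first.
  by apply/measurable_EFinP; exact: measurable_indic.
apply: ge0_le_integral => //.
- by move=> x _; rewrite -EFinM lee_fin mulr_ge0.
- by apply/measurable_EFinP; apply: measurable_funM.
- exact: measurable_sum_indic.
- move=> x _; rewrite -EFinM lee_fin indicE.
  have [/set_mem/Bc|_] := boolP (x \in B); first by rewrite mulr1.
  by rewrite mulr0 sumr_ge0.
Qed.

End RealMeasure.

Section FiniteValued.
Context {d : measure_display} {X : measurableType d}.

Definition finitely_measurable (K : finType) (Q : X -> K) : Prop :=
  forall k, measurable (Q @^-1` [set k]).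

Lemma finitely_measurable_pred (K : finType) (Q : X -> K) (b : pred K) :
  finitely_measurable Q -> measurable [set x | b (Q x)].
Proof.
move=> mQ.
have -> : [set x | b (Q x)] =
    \big[setU/set0]_(k <- enum K | b k) (Q @^-1` [set k]).
  rewrite -bigcup_seq_cond; apply/seteqP; split => x /=.
    by move=> bx; exists (Q x) => //=; rewrite mem_enum.
  by move=> [k /= /andP[_ bk] ->].
exact: bigsetU_measurable.
Qed.

Lemma finitely_measurable_comp (K L : finType) (Q : X -> K) (g : K -> L) :
  finitely_measurable Q -> finitely_measurable (fun x => g (Q x)).
Proof.
move=> mQ l.
have -> : (fun x => g (Q x)) @^-1` [set l] = [set x | g (Q x) == l].
  by apply/seteqP; split => x /= /eqP.
exact: (@finitely_measurable_pred _ _ (fun k => g k == l)).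
Qed.

(** The complement of the preimage of a word [w] is the union, over the
    coordinates, of the sets of disagreement with [w]. *)
Lemma finitely_measurable_ffun (I K : finType) (Q : I -> X -> K) :
  (forall i, finitely_measurable (Q i)) ->
  finitely_measurable (fun x => [ffun i => Q i x]).
Proof.
move=> mQ w.
have -> : (fun x => [ffun i => Q i x]) @^-1` [set w] =
    ~` (\big[setU/set0]_(i <- enum I) [set x | Q i x != w i]).
  rewrite -bigcup_seq; apply/seteqP; split => x /=.
    by move=> <- [i _ /=]; rewrite ffunE eqxx.
  move=> nx; apply/ffunP => i; rewrite ffunE; apply/eqP/negPn/negP => ne.
  by apply: nx; exists i => //=; rewrite mem_enum.
apply/measurableC/bigsetU_measurable => i _.
exact: (@finitely_measurable_pred _ _ (fun k => k != w i)).
Qed.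

Lemma finitely_measurable_neq (K : finType) (P Q : X -> K) :
  finitely_measurable P -> finitely_measurable Q ->
  measurable [set x | P x != Q x].
Proof.
move=> mP mQ.
have mPQ : finitely_measurable
    (fun x => [ffun b : bool => (if b then P else Q) x]).
  apply: (@finitely_measurable_ffun _ _ (fun b : bool => if b then P else Q)).
  by case.
have := @finitely_measurable_pred _ _
  (fun w : {ffun bool -> K} => w true != w false) mPQ.
by congr measurable; apply/funext => x /=; rewrite !ffunE.
Qed.

End FiniteValued.

(** * Iterates, displacement and the Hamming distance *)

Section Iterates.
Context {R : realType} {d : measure_display} {X : measurableType d}.
Variables (mu : probability X R) (T : X -> X).
Hypothesis hT : invertible_measure_preserving mu T.

Lemma measurable_iter n A : measurable A -> measurable (iter n T @^-1` A).
Proof.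
case: hT => _ mT _ _; elim: n A => [|n IH] A mA //.
exact: (IH _ (mT _ mA)).
Qed.

Lemma vol_iter n A : measurable A -> vol mu (iter n T @^-1` A) = vol mu A.
Proof.
case: hT => _ mT _ pT; elim: n A => [|n IH] A mA //.
by rewrite [LHS](IH _ (mT _ mA)) /vol pT.
Qed.

Lemma finitely_measurable_iter (K : finType) (Q : X -> K) n :
  finitely_measurable Q -> finitely_measurable (fun x => Q (iter n T x)).
Proof. by move=> mQ k; exact: (measurable_iter n (mQ k)). Qed.

Definition displaced (K : finType) (Q : X -> K) (n : nat) : set X :=
  [set x | Q (iter n T x) != Q x].

Lemma measurable_displaced (K : finType) (Q : X -> K) n :
  finitely_measurable Q -> measurable (displaced Q n).
Proof.
move=> mQ; apply: finitely_measurable_neq => //.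
exact: finitely_measurable_iter.
Qed.

(** By invariance of [mu], comparing times [n + i] and [i] costs no more than
    comparing times [n] and [0]. *)
Lemma vol_disagree (K : finType) (Q : X -> K) n i : finitely_measurable Q ->
  vol mu [set x | Q (iter (n + i) T x) != Q (iter i T x)] =
  vol mu (displaced Q n).
Proof.
move=> mQ; rewrite -(vol_iter i (measurable_displaced n mQ)).
by congr vol; apply/funext => x; rewrite /= iterD.
Qed.

End Iterates.

Section Hamming.
Context {R : realType} {d : measure_display} {X : measurableType d}.
Variables (mu : probability X R) (T : X -> X).
Hypothesis hT : invertible_measure_preserving mu T.
Variables (r : nat) (P : X -> 'I_r) (F : {fset nat}).

Local Notation hamming := (@hamming R d X T r P F).
Local Notation diam := (@diam R d X T r P F).

Lemma hamming_le1 x y : hamming x y <= 1.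
Proof.
rewrite /Defs.hamming; have [->|F0] := eqVneq F fset0.
  by rewrite big_seq_fset0 mul0r.
rewrite ler_pdivrMr ?ltr0n ?cardfs_gt0// mul1r.
apply: (@le_trans _ _ (\sum_(f <- F) 1)).
  by apply: ler_sum => f _; case: (_ != _).
by rewrite big_const_seq count_predT iter_addr_0 cardfE -cardfE.
Qed.

Lemma hamming_le_diam (E : set X) x y : E x -> E y -> hamming x y <= diam E.
Proof.
move=> Ex Ey; apply: ub_le_sup; last by exists x => //; exists y.
by exists 1 => _ [u _ [v _ <-]]; exact: hamming_le1.
Qed.

Lemma diam_le (E : set X) e : 0 <= e ->
  (forall x y, E x -> E y -> hamming x y <= e) -> diam E <= e.
Proof.
move=> e0 Ee; rewrite /Defs.diam.
set S := [set _ | _ in _ & _ in _].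
have [->|/set0P S0] := eqVneq S set0; first by rewrite sup0.
by apply: ge_sup => // _ [u Eu [v Ev <-]]; exact: Ee.
Qed.

Hypothesis mP : measurable_partition P.

(** The name of [x] along [F]; the Hamming distance depends on the two names
    only, and a name takes finitely many values, hence everything defined from
    it is measurable. *)
Definition word (x : X) : {ffun F -> 'I_r} := [ffun f => P (iter (val f) T x)].

Lemma finitely_measurable_word : finitely_measurable word.
Proof.
apply: (@finitely_measurable_ffun _ _ _ _
  (fun (f : F) x => P (iter (val f) T x))).
by move=> f; exact: (finitely_measurable_iter hT).
Qed.

End Hamming.

(** * Small covers force recurrence *)

Section Recurrence.
Context {R : realType} {d : measure_display} {X : measurableType d}.
Variables (mu : probability X R) (T : X -> X).
Hypothesis hT : invertible_measure_preserving mu T.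

Lemma hamming_word (r : nat) (P : X -> 'I_r) (F : {fset nat}) x y :
  hamming T P F x y =
  (\sum_(f : F) (word T P F x f != word T P F y f)%:R) / #|{: F}|%:R :> R.
Proof.
rewrite /hamming big_seq_fsetE cardfE; congr (_ / _).
by apply: eq_bigr => f _; rewrite !ffunE.
Qed.

Lemma probability_point : exists x : X, True.
Proof.
apply: contrapT => nX; suff : mu setT = 0%E.
  by rewrite probability_setT => /eqP; rewrite onee_eq0.
rewrite (_ : setT = set0) ?measure0//.
by apply/seteqP; split => // x _; apply: nX; exists x.
Qed.

(** Pigeonhole on columns.  The covering sets themselves need not be measurable,
    so they are replaced by Hamming balls around a point of each of them. *)
Lemma coverable_recurrence (r : nat) (P : X -> 'I_r) (F : {fset nat}) (eps : R)
    (M N : nat) : measurable_partition P -> 0 < eps -> (0 < N)%N ->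
  coverable mu T P F eps M -> (2 * (r ^ M * N) < #|` F|)%N ->
  exists h, (N <= h)%N /\ vol mu (displaced T P h) <= 5 * eps.
Proof.
move=> mP e0 N0 [E [dE mE muE]] cardF.
(* Any point will do for an empty covering set. *)
have [c cE] : exists c : 'I_M -> X,
    forall i x, E i x -> hamming T P F x (c i) <= eps.
  suff /choice[c cE] : forall i, exists y,
      forall x, E i x -> hamming T P F x y <= eps.
    by exists c.
  move=> i; have [Ei0|/set0P[y Ey]] := eqVneq (E i) set0.
    by have [y _] := probability_point; exists y => x; rewrite Ei0.
  exists y => x Ex; apply: le_trans (dE i); exact: hamming_le_diam.
have {cardF} : (2 * (r ^ M * N) < #|{: F}|)%N by rewrite -cardfE.
have mW := finitely_measurable_word hT (F := F) mP.
set W := word T P F in mW *.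
set n := #|{: F}| => cardF.
(* [sel] attaches to a name one of the balls containing it; [bad f] is where
   the letter at time [f] differs from that of the centre of this ball. *)
pose sel (w : {ffun F -> 'I_r}) := [pick i : 'I_M |
  (\sum_(f : F) (w f != W (c i) f)%:R) / n%:R <= eps :> R].
pose wrong f (w : {ffun F -> 'I_r}) :=
  if sel w is Some i then w f != W (c i) f else false.
pose bad (f : F) := [set x | wrong f (W x)].
pose rest := [set x | sel (W x) == None].
have mbad f : measurable (bad f).
  exact: (finitely_measurable_pred (wrong f) mW).
have mrest : measurable rest.
  exact: (finitely_measurable_pred (fun w => sel w == None) mW).
have n0 : 0 < n%:R :> R by rewrite ltr0n (leq_trans _ cardF).
have rest_le : vol mu rest <= eps.
  have : vol mu rest <= vol mu (~` \bigcup_i E i).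
    apply: le_vol => //; first exact: measurableC.
    move=> x /eqP + [i _ Eix]; rewrite /sel; case: pickP => // /(_ i).
    by rewrite -[n]/#|{: F}| -hamming_word cE.
  rewrite vol_setC// => /le_trans; apply.
  by move: muE; rewrite volE// lee_fin; lra.
have sum_bad : \sum_(f : F) vol mu (bad f) <= eps * n%:R.
  apply: sum_vol_le => // x.
  have indE f : \1_(bad f) x = (wrong f (W x))%:R :> R.
    rewrite indicE; congr (nat_of_bool _)%:R.
    by apply/idP/idP => [/set_mem|/mem_set].
  under eq_bigr do rewrite indE.
  rewrite /wrong /=; case E1 : (sel (W x)) => [i|]; last first.
    by rewrite big1 ?mulr_ge0// ?ltW//.
  move: E1; rewrite /sel; case: pickP => // j + [<-].
  by rewrite ler_pdivrMr.
(* The bad sets have mean volume at most [eps], so at least half of the times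
   have a bad set of volume at most [2 * eps]. *)
pose good := [pred f : F | vol mu (bad f) <= 2 * eps].
have card_good : (n <= 2 * #|good|)%N.
  have : (2 * eps) * #|[predC good]|%:R <= eps * n%:R.
    apply: le_trans sum_bad.
    rewrite (bigID good) /= -[leLHS]add0r lerD ?sumr_ge0//.
      by move=> f _; exact: vol_ge0.
    rewrite mulr_natr -sumr_const.
    by apply: ler_sum => f; rewrite inE /= -ltNge => /ltW.
  rewrite (mulrC 2) -mulrA ler_pM2l// -natrM ler_nat.
  by rewrite -[n](cardC good) !mul2n -!addnn leq_add2r leq_add2l.
(* Equal residues mod [N] of distinct times put them at distance at least
   [N]. *)
pose code (f : F) := ([ffun i => W (c i) f], Ordinal (ltn_pmod (val f) N0)).
have : ~~ dinjectiveb code good.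
  apply/dinjectiveP => /leq_card_in.
  rewrite card_prod card_ffun !card_ord => le_good.
  have := leq_trans cardF card_good.
  by rewrite ltn_mul2l /= ltnNge le_good.
case/dinjectivePn => f gf [f' /andP[/= ff' gf'] codeE].
have {ff' gf gf' codeE} [i [j [iltj gi gj colE modE]]] : exists i j : F,
    [/\ (val i < val j)%N, vol mu (bad i) <= 2 * eps, vol mu (bad j) <= 2 * eps,
        forall k, W (c k) i = W (c k) j & val i = val j %[mod N]].
  case: codeE => /ffunP colE modE.
  move: gf gf'; rewrite !inE => gf gf'.
  have {}colE k : W (c k) f = W (c k) f' by have := colE k; rewrite !ffunE.
  case: (ltngtP (val f) (val f')) => [lt|gt|/val_inj ffE].
  - by exists f, f'.
  - by exists f', f; split.
  - by rewrite ffE eqxx in ff'.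
exists (val j - val i)%N; split.
  apply: dvdn_leq; first by rewrite subn_gt0.
  by rewrite -eqn_mod_dvd ?modE// ltnW.
rewrite -(vol_disagree hT _ (val i))// subnK ?(ltnW iltj)//.
apply: (@le_trans _ _ (vol mu ((bad j `|` bad i) `|` rest))).
  apply: le_vol => //.
  - by apply: finitely_measurable_neq; exact: (finitely_measurable_iter hT).
  - by do 2 apply: measurableU => //.
  - move=> x /= ne; rewrite /bad /wrong /rest /=.
    case: (sel (W x)) => [k|]; last by right.
    left; have [Wi|Wi] := eqVneq (W x i) (W (c k) i); last by right.
    left; apply: contra ne => /eqP Wj; apply/eqP.
    by move: Wi; rewrite colE -Wj !ffunE => ->.
have := vol_setU mu (measurableU _ _ (mbad j) (mbad i)) mrest.
have := vol_setU mu (mbad j) (mbad i).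
lra.
Qed.

End Recurrence.

(** * Slow entropy zero and sizes of Folner sets *)

Section Entropy.
Context {R : realType} {d : measure_display} {X : measurableType d}.
Variables (mu : probability X R) (T : X -> X).

Lemma cov_ge0 (r : nat) (P : X -> 'I_r) (F : {fset nat}) (eps : R) :
  (0 <= cov mu T P F eps)%E.
Proof. by apply: le_ereal_inf_tmp => _ [M _ <-]; rewrite lee_fin. Qed.

(** With [coverable_slow_entropy0] below, this restates vanishing slow entropy
    in terms of covers, free of suprema, limits and extended reals. *)
Lemma slow_entropy0_coverable (U : nat -> R) (F : nat -> {fset nat}) (r : nat)
    (P : X -> 'I_r) (eps c : R) :
  slow_entropy mu T U F = 0%E -> measurable_partition P -> 0 < eps -> 0 < c ->
  (\forall n \near \oo, 0 < U #|` F n|) ->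
  \forall n \near \oo, exists M,
    coverable mu T P (F n) eps M /\ M%:R < c * U #|` F n|.
Proof.
move=> h0 mP e0 c0 Upos.
have : (limn_esup (fun n => cov mu T P (F n) eps / (U #|` F n|)%:E) < c%:E)%E.
  apply: le_lt_trans (_ : 0%E < c%:E)%E; last by rewrite lte_fin.
  rewrite -h0; apply: (@le_trans _ _ (slow_entropy_partition mu T U F P)).
    by apply: ereal_sup_ubound; exists eps.
  by apply: ereal_sup_ubound; exists r, P.
move=> /ereal_inf_lt[_ [V Voo <-] supV].
near=> n.
have U0 : 0 < U #|` F n| by near: n.
have : (cov mu T P (F n) eps / (U #|` F n|)%:E < c%:E)%E.
  apply: le_lt_trans supV; apply: ereal_sup_ubound; exists n => //.
  by near: n.
rewrite inver gt_eqF// lte_pdivrMr// -EFinM => /ereal_inf_lt[_ [M covM <-]].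
by rewrite lte_fin => MU; exists M.
Unshelve. all: by end_near. Qed.

(** The hypothesis bounds every upper limit above by zero; they are also
    nonnegative, and the trivial partition makes the outer supremum one over a
    nonempty set. *)
Lemma coverable_slow_entropy0 (U : nat -> R) (F : nat -> {fset nat}) :
  (\forall n \near \oo, 0 < U #|` F n|) ->
  (forall r (P : X -> 'I_r) (eps c : R),
     measurable_partition P -> 0 < eps -> 0 < c ->
     \forall n \near \oo, exists M,
       coverable mu T P (F n) eps M /\ M%:R <= c * U #|` F n|) ->
  slow_entropy mu T U F = 0%E.
Proof.
move=> Upos small.
have ratio_ge0 r (P : X -> 'I_r) eps : \forall n \near \oo,
    (0 <= cov mu T P (F n) eps / (U #|` F n|)%:E)%E.
  near=> n; apply: mule_ge0; first exact: cov_ge0.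
  by rewrite inve_ge0 lee_fin ltW//; near: n.
have limsup0 r (P : X -> 'I_r) (eps : R) : measurable_partition P -> 0 < eps ->
    limn_esup (fun n => cov mu T P (F n) eps / (U #|` F n|)%:E)%E = 0%E.
  move=> mP e0; apply/eqP; rewrite eq_le; apply/andP; split.
    apply/lee_addgt0Pr => c c0; rewrite add0e.
    have evc : \forall n \near \oo,
        (cov mu T P (F n) eps / (U #|` F n|)%:E <= c%:E)%E.
      near=> n.
      have U0 : 0 < U #|` F n| by near: n.
      rewrite inver gt_eqF// lee_pdivrMr// -EFinM.
      have [M [covM MU]] : exists M,
          coverable mu T P (F n) eps M /\ M%:R <= c * U #|` F n|.
        by near: n; exact: small.
      apply: (@le_trans _ _ (M%:R)%:E); last by rewrite lee_fin.
      by apply: ereal_inf_lbound; exists M.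
    pose V := [set n | cov mu T P (F n) eps / (U #|` F n|)%:E <= c%:E]%E.
    apply: (@le_trans _ _ (ereal_sup
        [set cov mu T P (F n) eps / (U #|` F n|)%:E | n in V]))%E.
      by apply: ereal_inf_lbound; exists V.
    by apply: ge_ereal_sup => _ [n evn <-]; exact: evn.
  apply: le_ereal_inf_tmp => _ [V Voo <-].
  have [n [Vn n0]] := filter_ex (filterI Voo (ratio_ge0 r P eps)).
  by apply: le_trans n0 _; apply: ereal_sup_ubound; exists n.
have part0 r (P : X -> 'I_r) : measurable_partition P ->
    slow_entropy_partition mu T U F P = 0%E.
  move=> mP; apply/eqP; rewrite eq_le; apply/andP; split.
    by apply: ge_ereal_sup => _ [e /= e0 <-]; rewrite limsup0.
  apply: ereal_sup_ubound; exists 1; first exact: ltr01.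
  by apply: limsup0 => //; exact: ltr01.
apply/eqP; rewrite eq_le; apply/andP; split.
  by apply: ge_ereal_sup => _ [r [P [mP ->]]]; rewrite part0.
apply: ereal_sup_ubound; exists 1%N, (fun _ => ord0).
have m1 : measurable_partition (fun _ : X => ord0 : 'I_1).
  move=> i; have -> : (fun _ : X => ord0 : 'I_1) @^-1` [set i] = setT.
    by apply/seteqP; split => x //= _; rewrite (ord1 i).
  exact: measurableT.
by split => //; rewrite part0.
Unshelve. all: by end_near. Qed.

End Entropy.

Section Folner.
Context {R : realType}.

(** The minimum of [A] does not belong to [A + 1]. *)
Lemma card_translate_lt (A : {fset nat}) : A != fset0 ->
  (#|` [fset (x + 1)%N | x in A] `&` A|%fset < #|` A|)%N.
Proof.
move=> A0; apply/fproper_ltn_card/fproperIr/negP => /fsubsetP subA.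
have [a aA am] : exists2 a, a \in A & forall b, b \in A -> (a <= b)%N.
  have /fset0Pn[a0 a0A] := A0.
  have exA : exists a, a \in A by exists a0.
  by exists (ex_minn exA); case: ex_minnP.
have /imfsetP[b /= bA ab] := subA a aA.
by have := am b bA; rewrite ab addn1 ltnn.
Qed.

(** The ratio for the translation by [1] is at most [1 - 1 / #|F n|]. *)
Lemma folner_card (F : nat -> {fset nat}) (K : nat) : folner R F ->
  \forall n \near \oo, (K < #|` F n|)%N.
Proof.
move=> [F0 /(_ 1%N) /cvgrPdist_lt /(_ K.+1%:R^-1)].
rewrite invr_gt0 ltr0n => /(_ isT); apply: filterS => n.
have Fn0 : 0 < #|` F n|%:R :> R by rewrite ltr0n cardfs_gt0.
have := card_translate_lt (F0 n); rewrite -(ler_nat R) -natr1.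
set a := #|` _|%fset => le_a.
have {}le_a : a%:R / #|` F n|%:R <= 1 - #|` F n|%:R^-1 :> R.
  by rewrite ler_pdivrMr// mulrBl mul1r mulVf ?gt_eqF//; lra.
move=> /(le_lt_trans (ler_norm _)) lt1.
have : #|` F n|%:R^-1 < K.+1%:R^-1 :> R.
  by apply: le_lt_trans lt1; rewrite lerBrDr addrC -lerBrDr.
by rewrite ltf_pV2 ?posrE ?ltr0n ?cardfs_gt0// ltr_nat => /ltnW.
Qed.

End Folner.

(** * Countable generation of standard spaces *)

Section SecondCountable.
Context {R : realType}.

(** The base consists of the interiors of the balls of radius [1 / (m + 1)]
    around the points of a countable dense set [D]. *)
Lemma separable_countable_base (Y : metricType R) : separable Y ->
  exists B : nat -> set Y, (forall k, open (B k)) /\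
    forall U y, open U -> U y -> exists k, B k y /\ B k `<=` U.
Proof.
move=> [D [/countable_injP[g ginj] dD]].
(* [g] numbers the points of [D], so this union is over at most one point. *)
pose S i m := \bigcup_(q in [set q | D q /\ g q = i])
  (ball q m.+1%:R^-1 : set Y)^°.
pose B (k : nat) := let p := odflt (0%N, 0%N) (choice.unpickle k) in S p.1 p.2.
have oS i m : open (S i m) by apply: bigcup_open => q _; exact: open_interior.
exists B; split => [k|U y oU Uy]; first exact: oS.
have [e /= e0 yeU] : exists2 e : R, 0 < e & ball y e `<=` U.
  by apply/nbhs_ballP; exact: open_nbhs_nbhs.
have [m me] : exists m, m.+1%:R^-1 < e / 2 :> R.
  have e20 : 0 < e / 2 by rewrite divr_gt0.
  have [m _ mP] := near_infty_natSinv_lt (PosNum e20).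
  exists m; exact: (mP m (leqnn m)).
have hm0 : 0 < m.+1%:R^-1 / 2 :> R by rewrite divr_gt0// invr_gt0.
have [q [yq Dq]] : ((ball y (m.+1%:R^-1 / 2))^° `&` D) !=set0.
  apply: dD; last exact: open_interior.
  exists y; exact: nbhsx_ballx.
have {}yq : ball y (m.+1%:R^-1 / 2) q by exact: interior_subset yq.
exists (choice.pickle (g q, m)); rewrite /B choice.pickleK /=; split.
  exists q => //; rewrite /interior; apply/nbhs_ballP.
  exists (m.+1%:R^-1 / 2) => // z yz.
  rewrite [m.+1%:R^-1]splitr; apply: ball_triangle yz; exact: ball_sym.
move=> z [q' [Dq' gq'] /interior_subset q'z]; apply: yeU.
have {Dq' gq'} qq' : q' = q by apply: ginj; rewrite ?inE.
rewrite {}qq' in q'z; rewrite [e]splitr; apply: (@ball_triangle _ _ q).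
  apply: le_ball yq; apply: ltW; apply: lt_trans me.
  by rewrite ltr_pdivrMr// ltr_pMr ?invr_gt0// ltr1n.
by apply: le_ball q'z; exact: ltW.
Qed.

Context {d : measure_display} {X : measurableType d}.
Variable mu : probability X R.

(** Generation of the sigma-algebra up to null sets, phrased as the induction
    principle through which it is used. *)
Definition generates_mod_null (B : nat -> set X) : Prop :=
  forall C : set (set X),
    (forall k, C (B k)) -> C set0 ->
    (forall A, C A -> C (~` A)) ->
    (forall A : (set X)^nat, (forall k, C (A k)) -> C (\bigcup_k A k)) ->
    (forall A A' N, C A -> measurable A' -> measurable N -> mu N = 0%E ->
       A' `+` A `<=` N -> C A') ->
    forall A, measurable A -> C A.

(** The base of the topology generates the Borel sets, and every measurable set
    is Borel up to a null set. *)
Lemma standard_generates_mod_null : standard_probability_space mu ->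
  exists B : nat -> set X,
    (forall k, measurable (B k)) /\ generates_mod_null B.
Proof.
move=> [Y [f [_ _ /separable_countable_base[B [oB baseB]] mf fB]]].
have mo V : open V -> measurable (f @^-1` V).
  by move=> oV; apply: mf; exact: sub_sigma_algebra.
exists (fun k => f @^-1` B k); split => [k|C CB C0 CC CU CN A mA].
  exact: mo.
have [V [N [bV bN N0 AVN]]] := fB A mA.
apply: (CN (f @^-1` V) A (f @^-1` N)) => //; last exact: mf.
have : [set V | C (f @^-1` V)] V; last by [].
apply: smallest_sub bV; last first.
  move=> U /= oU.
  have -> : U = \bigcup_k (if `[< B k `<=` U >] then B k else set0).
    apply/seteqP; split => [y Uy|y [k _]].
      have [k [By BU]] := baseB _ _ oU Uy.
      by exists k => //; rewrite asboolT.
    by case: asboolP => // BU /BU.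
  rewrite preimage_bigcup; apply: CU => k.
  by case: asboolP => _; [exact: CB | rewrite preimage_set0].
split => /=.
- by rewrite preimage_set0.
- by move=> G CG; rewrite setTD preimage_setC; exact: CC.
- by move=> G CG; rewrite preimage_bigcup; exact: CU.
Qed.

End SecondCountable.

(** * The sigma-algebra of sets rigid along a sequence *)

Section RigidSequences.
Context {R : realType} {d : measure_display} {X : measurableType d}.
Variables (mu : probability X R) (T : X -> X).
Hypothesis hT : invertible_measure_preserving mu T.

Definition moved (A : set X) (n : nat) : set X := (iter n T @^-1` A) `+` A.

Lemma measurable_moved A n : measurable A -> measurable (moved A n).
Proof.
move=> mA; have mTA := measurable_iter hT n mA.
by apply: measurableU; apply: measurableD.
Qed.

Definition rigid_along (n : nat -> nat) (A : set X) : Prop :=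
  measurable A /\
  forall e : R, 0 < e -> \forall k \near \oo, vol mu (moved A (n k)) <= e.

Lemma rigid_alongP n A : measurable A ->
  rigid_along n A <-> mu (moved A (n k)) @[k --> \oo] --> 0%E.
Proof.
move=> mA; split => [[_ nA]|nA].
  apply/fine_cvgP; split.
    by apply: nearW => k; rewrite fin_num_measure//; exact: measurable_moved.
  apply/cvgrPdist_le => e e0; near=> k.
  rewrite sub0r normrN ger0_norm; last exact: vol_ge0.
  by near: k; exact: nA.
split => // e e0; move/fine_cvgP: nA => [_ /cvgrPdist_le/(_ e e0)].
apply: filterS => k /=.
by rewrite sub0r normrN ger0_norm//; exact: vol_ge0.
Unshelve. all: by end_near. Qed.

Lemma moved_setC A n : moved (~` A) n = moved A n.
Proof.
rewrite /moved /setY preimage_setC.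
by rewrite !setDE !setCK [RHS]setUC setIC; congr (_ `|` _); rewrite setIC.
Qed.

Lemma moved_bigsetU (A : nat -> set X) N n :
  moved (\big[setU/set0]_(i < N) A i) n `<=`
  \big[setU/set0]_(i < N) moved (A i) n.
Proof.
rewrite -bigcup_mkord -(bigcup_mkord N (fun i => moved (A i) n)).
move=> x [[[i iN Ai] nA]|[[i iN Ai] nA]].
  by exists i => //; left; split => // Aix; apply: nA; exists i.
by exists i => //; right; split => // Aix; apply: nA; exists i.
Qed.

(** [A] and its subset [B] differ little when [A `\` B] is small, and so do
    their preimages; the factor [2] counts both. *)
Lemma vol_moved_le (A B : set X) n : measurable A -> measurable B -> B `<=` A ->
  vol mu (moved A n) <= vol mu (moved B n) + 2 * vol mu (A `\` B).
Proof.
move=> mA mB BA; have mAB := measurableD mA mB.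
have mTAB := measurable_iter hT n mAB.
have mBn := measurable_moved n mB.
apply: (@le_trans _ _
    (vol mu ((moved B n `|` (A `\` B)) `|` (iter n T @^-1` (A `\` B))))).
  apply: le_vol; first exact: measurable_moved.
    by apply: measurableU => //; exact: measurableU.
  move=> x [[/= TAx nAx]|[/= Ax nTAx]].
    have [TBx|nTBx] := pselect (B (iter n T x)); last by right.
    by left; left; left; split => // /BA.
  have [Bx|nBx] := pselect (B x); last by left; right.
  by left; left; right; split => //= /BA.
have := vol_setU mu (measurableU _ _ mBn mAB) mTAB.
have := vol_setU mu mBn mAB.
rewrite (vol_iter hT)//; lra.
Qed.

Lemma vol_setD_lim (A : nat -> set X) (e : R) : (forall k, measurable (A k)) ->
  0 < e ->
  exists N, vol mu (\bigcup_k A k `\` \big[setU/set0]_(i < N) A i) <= e.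
Proof.
move=> mA e0.
have mU : measurable (\bigcup_k A k) by exact: bigcupT_measurable.
pose AN N := \big[setU/set0]_(i < N) A i.
have mAN N : measurable (AN N) by exact: bigsetU_measurable.
have UAN : \bigcup_N AN N = \bigcup_k A k.
  apply/seteqP; split=> [x [N _]|x [k _ Ax]]; first exact: bigsetU_bigcup.
  by exists k.+1 => //; rewrite /AN big_ord_recr; right.
have cvgAN : mu (AN N) @[N --> \oo] --> mu (\bigcup_k A k).
  rewrite -UAN; apply: nondecreasing_cvg_mu => //; first by rewrite UAN.
  by move=> m n mn; apply/subsetPset; exact: subset_bigsetU.
rewrite volE// in cvgAN.
have /fine_cvgP[_ /cvgrPdist_le/(_ e e0)[N _ le_e]] := cvgAN.
have {le_e} /= le_e := le_e N (leqnn N).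
exists N; have sub : AN N `<=` \bigcup_k A k by exact: bigsetU_bigcup.
have -> : vol mu (\bigcup_k A k `\` AN N) =
    vol mu (\bigcup_k A k) - vol mu (AN N).
  apply/eqP; rewrite -eqe EFinB -!volE//; last exact: measurableD.
  rewrite measureD//; last by rewrite -ge0_fin_numE// fin_num_measure.
  by rewrite setIidr.
exact: le_trans (ler_norm _) le_e.
Qed.

(** A countable union is approximated by a finite one, for which the moved parts
    add up. *)
Lemma rigid_along_bigcup n (A : nat -> set X) :
  (forall i, rigid_along n (A i)) -> rigid_along n (\bigcup_i A i).
Proof.
move=> nA; have mA i : measurable (A i) by have [] := nA i.
have mU : measurable (\bigcup_k A k) by exact: bigcupT_measurable.
split => // e e0.
have e4 : 0 < e / 4 by rewrite divr_gt0.
have [N volN] := vol_setD_lim mA e4.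
have eN : 0 < e / 2 / N.+1%:R by rewrite !divr_gt0.
(* [N.+1] rather than [N], since [N] may be zero. *)
have : \forall k \near \oo, forall i : 'I_N,
    vol mu (moved (A i) (n k)) <= e / 2 / N.+1%:R.
  by apply: filter_forall => i; have [_] := nA i; exact.
apply: filterS => k Nk.
have mB : measurable (\big[setU/set0]_(i < N) A i) by exact: bigsetU_measurable.
apply: le_trans (vol_moved_le (n k) mU mB (@bigsetU_bigcup _ _ _)) _.
suff : vol mu (moved (\big[setU/set0]_(i < N) A i) (n k)) <= e / 2.
  by move: volN; lra.
have mM i : measurable (moved (A i) (n k)) by exact: measurable_moved.
apply: le_trans (_ : vol mu (\big[setU/set0]_(i < N) moved (A i) (n k)) <= _).
  apply: le_vol; [exact: measurable_moved|exact: bigsetU_measurable|].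
  exact: moved_bigsetU.
apply: le_trans (vol_bigsetU _ _ _) _ => //.
apply: (@le_trans _ _ (\sum_(i < N) e / 2 / N.+1%:R)); first exact: ler_sum.
rewrite sumr_const card_ord -[leLHS]mulr_natr -[leLHS]mulrA ger_pMr ?divr_gt0//.
by rewrite mulrC ler_pdivrMr// mul1r ler_nat.
Qed.

(** The sets that are rigid along [n] form a sigma-algebra containing the null
    sets, so rigidity need only be checked on countably many generators. *)
Lemma rigid_along_all (n : nat -> nat) (B : nat -> set X) :
  generates_mod_null mu B ->
  (forall k, rigid_along n (B k)) ->
  forall A, measurable A -> rigid_along n A.
Proof.
move=> ind nB; apply: ind => //.
- split => // e e0; apply: nearW => k.
  by rewrite /moved preimage_set0 setYK /vol measure0 ltW.
- move=> A [mA nA]; split; first exact: measurableC.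
  by move=> e e0; under eq_near do rewrite moved_setC; exact: nA.
- exact: rigid_along_bigcup.
move=> A A' N [mA nA] mA' mN N0 AN; split => // e /nA; apply: filterS => k.
apply: le_trans.
have mTN := measurable_iter hT (n k) mN.
have volN : vol mu N = 0 by rewrite /vol N0.
have mM := measurable_moved (n k) mA.
apply: (@le_trans _ _
    (vol mu ((moved A (n k) `|` N) `|` (iter (n k) T @^-1` N)))).
  apply: le_vol; first exact: measurable_moved.
    by apply: measurableU => //; exact: measurableU.
  have out x : ~ N x -> A x <-> A' x.
    move=> Nx; split=> Ax; apply: contrapT => nAx; apply: Nx; apply: AN.
      by right.
    by left.
  move=> x Mx; have [Nx|Nx] := pselect (N x); first by left; right.
  have [TNx|TNx] := pselect (N (iter (n k) T x)); first by right.
  have oTx := out _ TNx; have ox := out _ Nx; left; left.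
  case: Mx => -[/= A1 A2]; [left|right]; rewrite /setD /=; tauto.
have := vol_setU mu (measurableU _ _ mM mN) mTN.
have := vol_setU mu mM mN.
rewrite (vol_iter hT)// volN; lra.
Qed.

End RigidSequences.

(** * From logarithmic covers to rigidity *)

Section RecurrenceRigidity.
Context {R : realType} {d : measure_display} {X : measurableType d}.
Variables (mu : probability X R) (T : X -> X).
Hypothesis hT : invertible_measure_preserving mu T.

Definition recurrent : Prop :=
  forall (r : nat) (P : X -> 'I_r) (e : R) (N : nat),
    measurable_partition P -> 0 < e ->
    exists h, (N <= h)%N /\ vol mu (displaced T P h) <= e.

(** Recurrence for the partition into the atoms of the first [k] sets. *)
Lemma recurrent_sets (B : nat -> set X) (k N : nat) (e : R) : recurrent ->
  (forall j, measurable (B j)) -> 0 < e ->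
  exists h, (N <= h)%N /\
    forall j, (j < k)%N -> vol mu (moved T (B j) h) <= e.
Proof.
move=> rec mB e0.
pose Q x := [ffun j : 'I_k => x \in B j].
have mQ : finitely_measurable Q.
  apply: (@finitely_measurable_ffun _ _ _ _ (fun (j : 'I_k) x => x \in B j)).
  move=> j [].
    rewrite (_ : _ @^-1` _ = B j)//.
    by apply/seteqP; split => x /=; [move/set_mem|move/mem_set].
  rewrite (_ : _ @^-1` _ = ~` B j); first exact: measurableC.
  apply/seteqP; split => x /=; first by move=> + /mem_set => ->.
  by move=> nBx; apply/negbTE/negP => /set_mem.
pose P x := enum_rank (Q x).
have mP : finitely_measurable P by exact: finitely_measurable_comp.
have [h [Nh dh]] := rec _ P e N mP e0.
exists h; split => // j jk; apply: le_trans dh.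
apply: le_vol; first exact: (measurable_moved hT).
  exact: (measurable_displaced hT).
move=> x Mx; apply/eqP => /enum_rank_inj/ffunP/(_ (Ordinal jk)).
rewrite !ffunE /=; case: Mx => -[/= A1 A2].
  by rewrite (mem_set A1) => /esym/set_mem.
by rewrite (mem_set A1) => /set_mem.
Qed.

(** Diagonal argument: the [k]-th return time is chosen after the previous one
    and nearly fixes the first [k] generators. *)
Lemma recurrent_rigid :
  standard_probability_space mu -> recurrent -> rigid mu T.
Proof.
move=> hX rec.
have [B [mB ind]] := standard_generates_mod_null hX.
have /choice[g gP] : forall p : nat * nat, exists h, (p.2 < h)%N /\
    forall j, (j < p.1)%N -> vol mu (moved T (B j) h) <= p.1.+1%:R^-1.
  by move=> [k N]; apply: recurrent_sets => //; rewrite invr_gt0.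
pose n := fix n k := if k is k'.+1 then g (k', n k') else 0%N.
exists n; split => // [k|A mA]; first by have [] := gP (k, n k).
apply/rigid_alongP => //; apply: (rigid_along_all hT ind) => // j.
split => // e e0.
have [m _ me] := near_infty_natSinv_lt (PosNum e0).
exists (maxn m j).+2 => // -[|k] //= lek.
have [_ /(_ j)/=] := gP (k, n k).
have jk : (j < k)%N by lia.
move=> /(_ jk)/le_trans; apply; apply: ltW; apply: me; rewrite /=; lia.
Qed.

(** From [r <= expR r]: this avoids the logarithm of [r], hence the case
    [r = 0]. *)
Lemma expn_le_of_ln (r M n : nat) : (0 < n)%N ->
  (r * (2 * M))%:R <= ln n%:R :> R -> (r ^ M * r ^ M <= n)%N.
Proof.
move=> n0 le_ln; rewrite -expnD addnn -mul2n -(ler_nat R) natrX.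
apply: le_trans (_ : expR r%:R ^+ (2 * M) <= _).
  apply: lerXn2r; rewrite ?nnegrE ?expR_ge0//.
  by apply: le_trans (expR_ge1Dx _); rewrite lerDr.
by rewrite -expRM_natl -natrM mulnC -[leRHS]lnK ?posrE ?ltr0n// ler_expR.
Qed.

(** The constant [1 / (2 (r + 1))] makes [r ^ M] at most the square root of
    [#|F n|], so that the pigeonhole applies once [#|F n|] is large. *)
Lemma log_entropy0_recurrent (F : nat -> {fset nat}) : folner R F ->
  slow_entropy mu T (log_rate R) F = 0%E -> recurrent.
Proof.
move=> fF h0 r P e N mP e0.
have e5 : 0 < e / 5 by rewrite divr_gt0.
have c0 : 0 < (2 * r.+1)%:R^-1 :> R by rewrite invr_gt0 ltr0n.
have Upos : \forall n \near \oo, 0 < log_rate R #|` F n|.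
  apply: filterS (folner_card 1 fF) => n n1.
  by rewrite /log_rate ln_gt0// ltr1n.
have [n [[M [covM ltM]] cardF]] := filter_ex (filterI
  (slow_entropy0_coverable h0 mP e5 c0 Upos)
  (folner_card (4 * (N.+1 * N.+1)) fF)).
have F0 : (0 < #|` F n|)%N by lia.
have le_card : (r ^ M * r ^ M <= #|` F n|)%N.
  apply: expn_le_of_ln => //.
  move: ltM; rewrite mulrC ltr_pdivlMr ?ltr0n// => /ltW; apply: le_trans.
  by rewrite -natrM ler_nat; nia.
have [] := @coverable_recurrence _ _ _ mu T hT r P (F n) (e / 5) M N.+1 mP e5
  (ltn0Sn N) covM.
  move: le_card cardF; generalize #|` F n| (r ^ M)%N => q p.
  by rewrite -(ltn_sqr (2 * _)); nia.
move=> h [Nh dh]; exists h; split; first exact: ltnW.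
by move: dh; rewrite mulrC divfK.
Qed.

End RecurrenceRigidity.

(** * Folner sets built from a rigidity sequence *)

Section Blocks.

(** The union of the translates [[h j, h j + N[], for [j < M]; the gap condition
    below makes them disjoint. *)
Definition block_points (N M : nat) (h : nat -> nat) : seq nat :=
  [seq (p.1 + h p.2)%N | p : 'I_N * 'I_M].

Definition block (N M : nat) (h : nat -> nat) : {fset nat} :=
  seq_fset tt (block_points N M h).

Variables (N M : nat) (h : nat -> nat).
Hypothesis gap : forall j, (h j + N <= h j.+1)%N.

Lemma block_inj i i' j j' : (i < N)%N -> (i' < N)%N ->
  (i + h j = i' + h j')%N -> i = i' /\ j = j'.
Proof.
move=> iN iN' ijE.
have step a b : (a < b)%N -> (h a + N <= h b)%N.
  elim: b => // b IH; rewrite ltnS leq_eqVlt => /orP[/eqP->//|/IH].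
  by have := gap b; lia.
case: (ltngtP j j') => [/step|/step|jE]; [lia|lia|].
by split => //; move: ijE; rewrite jE; lia.
Qed.

Lemma uniq_block_points : uniq (block_points N M h).
Proof.
rewrite map_inj_uniq ?enum_uniq// => -[i j] [i' j'] /= /block_inj[]//.
by move=> /val_inj -> /val_inj ->.
Qed.

Lemma perm_block : perm_eq (block N M h) (block_points N M h).
Proof.
apply: uniq_perm => //; first exact: uniq_block_points.
by move=> x; rewrite seq_fsetE.
Qed.

Lemma card_block : #|` block N M h| = (N * M)%N.
Proof.
by rewrite (perm_size perm_block) size_map -cardE card_prod !card_ord.
Qed.

Lemma sum_block (V : nmodType) (G : nat -> V) :
  \sum_(f <- block N M h) G f = \sum_(p : 'I_N * 'I_M) G (p.1 + h p.2)%N.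
Proof. by rewrite (perm_big _ perm_block) big_map big_enum. Qed.

(** Each of the [M] intervals keeps [N - k] of its points when shifted by
    [k]. *)
Lemma card_block_translate k :
  ((N - k) * M <=
   #|` [fset (x + k)%N | x in block N M h] `&` block N M h|%fset)%N.
Proof.
pose s := [seq (p.1 + k + h p.2)%N | p : 'I_(N - k) * 'I_M].
have -> : ((N - k) * M)%N = size s.
  by rewrite size_map -cardE card_prod !card_ord.
apply: uniq_leq_size.
  rewrite map_inj_uniq ?enum_uniq// => -[i j] [i' j'] /= /block_inj[].
  - by have := ltn_ord i; lia.
  - by have := ltn_ord i'; lia.
  - by move=> /addIn/val_inj -> /val_inj ->.
move=> x /mapP[[i j] _ -> /=]; rewrite in_fsetI; apply/andP; split.
  apply/imfsetP; exists (i + h j)%N; last by rewrite addnAC.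
  rewrite /= seq_fsetE; apply/mapP.
  have iN : (i < N)%N by have := ltn_ord i; lia.
  by exists (Ordinal iN, j) => //; rewrite mem_enum.
rewrite seq_fsetE; apply/mapP.
have iN : (i + k < N)%N by have := ltn_ord i; lia.
by exists (Ordinal iN, j) => //; rewrite mem_enum.
Qed.

End Blocks.

Section Forward.
Context {R : realType} {d : measure_display} {X : measurableType d}.
Variables (mu : probability X R) (T : X -> X).
Hypothesis hT : invertible_measure_preserving mu T.

(** Only the length of the intervals matters: the ratio for the translation by
    [k] is at least [1 - k / (n + 1)]. *)
Lemma folner_block (M : nat -> nat) (h : nat -> nat -> nat) :
  (forall n, (0 < M n)%N) ->
  (forall n j, (h n j + n.+1 <= h n j.+1)%N) ->
  folner R (fun n => block n.+1 (M n) (h n)).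
Proof.
move=> M0 gap; split => [n|k].
  by rewrite -cardfs_gt0 card_block// muln_gt0 M0.
apply/cvgrPdist_le => e e0; near=> n.
rewrite card_block//; set a := #|` _|%fset.
have aT : (a <= n.+1 * M n)%N.
  by rewrite -(card_block _ (gap n)) fsubset_leq_card// fsubsetIr.
have aB : ((n.+1 - k) * M n <= a)%N by exact: card_block_translate.
have NM0 : 0 < (n.+1 * M n)%:R :> R by rewrite ltr0n muln_gt0 M0.
have M0' : 0 < (M n)%:R :> R by rewrite ltr0n.
rewrite ger0_norm; last first.
  by rewrite subr_ge0 ler_pdivrMr// mul1r ler_nat.
rewrite lerBlDr -lerBlDl ler_pdivlMr//.
apply: (@le_trans _ _ ((n.+1 - k) * M n)%:R); last by rewrite ler_nat.
rewrite !natrM mulrA ler_pM2r// mulrBl mul1r.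
have kn : k%:R <= e * n.+1%:R.
  rewrite -ler_pdivrMl// mulrC.
  apply: (@le_trans _ _ n%:R); last by rewrite ler_nat.
  by near: n; exact: nbhs_infty_ger.
have : n.+1%:R - k%:R <= (n.+1 - k)%:R :> R.
  have [kn1|/ltnW nk1] := leqP k n.+1; first by rewrite natrB.
  by rewrite (le_trans _ (ler0n _ _))// subr_le0 ler_nat.
lra.
Unshelve. all: by end_near. Qed.

(** Points whose number of mismatches between the interval and its translates is
    below [e / 2] of the total are grouped by their names along the interval
    alone: two points of a group are [e]-close.  By Markov's inequality the
    bound [e ^ 2 / 2] leaves out a set of measure at most [e]. *)
Lemma coverable_block (r : nat) (P : X -> 'I_r) (N M : nat) (h : nat -> nat)
    (e : R) :
  (0 < N)%N -> (0 < M)%N -> (forall j, (h j + N <= h j.+1)%N) ->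
  measurable_partition P -> 0 < e ->
  (forall j : nat, (j < M)%N -> vol mu (displaced T P (h j)) <= e * e / 2) ->
  coverable mu T P (block N M h) e (r ^ N).
Proof.
move=> N0 M0 gap mP e0 small.
pose D (p : 'I_N * 'I_M) :=
  [set x | P (iter (h p.2 + p.1) T x) != P (iter p.1 T x)].
have mD p : measurable (D p).
  by apply: finitely_measurable_neq; exact: (finitely_measurable_iter hT).
have NM0 : 0 < (N * M)%:R :> R by rewrite ltr0n muln_gt0 N0.
pose mism x : R := \sum_(p : 'I_N * 'I_M) \1_(D p) x.
pose good := [set x | mism x <= e / 2 * (N * M)%:R].
have mgood : measurable good.
  have mm : measurable_fun setT mism.
    by apply: measurable_sum => p; exact: measurable_indic.
  have -> : good = setT `&` mism @^-1` `]-oo, e / 2 * (N * M)%:R].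
    by rewrite setTI; apply/seteqP; split => x /=; rewrite in_itv.
  exact: mm.
pose name x : {ffun 'I_N -> 'I_r} := [ffun i : 'I_N => P (iter i T x)].
have volgood : vol mu (~` good) <= e.
  have c0 : 0 < e / 2 * (N * M)%:R by rewrite mulr_gt0// divr_gt0.
  have : e / 2 * (N * M)%:R * vol mu (~` good) <= \sum_p vol mu (D p).
    apply: markov_count => //; first exact: ltW.
      exact: measurableC.
    by move=> x /negP; rewrite -ltNge => /ltW.
  have : \sum_p vol mu (D p) <= e * e / 2 * (N * M)%:R.
    apply: (@le_trans _ _ (\sum_(p : 'I_N * 'I_M) (e * e / 2))).
      by apply: ler_sum => p _; rewrite (vol_disagree hT)// small.
    by rewrite sumr_const card_prod !card_ord mulr_natr.
  move=> /[swap] /le_trans /[apply].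
  have -> : e * e / 2 * (N * M)%:R = e / 2 * (N * M)%:R * e by ring.
  by rewrite ler_pM2l.
have cardW : #|{ffun 'I_N -> 'I_r}| = (r ^ N)%N by rewrite card_ffun !card_ord.
pose E (w : 'I_(r ^ N)) :=
  good `&` [set x | name x = enum_val (cast_ord (esym cardW) w)].
have EU : \bigcup_w E w = good.
  apply/seteqP; split => [x [w _ []]//|x gx].
  exists (cast_ord cardW (enum_rank (name x))) => //; split => //=.
  by rewrite cast_ordK enum_rankK.
exists E; rewrite EU; split => // [w|].
  apply: diam_le => [|x y [gx /= nx] [gy /= ny]]; first exact: ltW.
  have nE (i : 'I_N) : P (iter i T x) = P (iter i T y).
    by have /ffunP/(_ i) : name x = name y by [rewrite nx ny]; rewrite !ffunE.
  rewrite /hamming sum_block// card_block// ler_pdivrMr//.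
  apply: (@le_trans _ _ (mism x + mism y)); last first.
    by move: gx gy; rewrite /good /=; lra.
  rewrite -big_split; apply: ler_sum => -[i j] _ /=.
  have indE z : \1_(D (i, j)) z =
      (P (iter (h j + i) T z) != P (iter i T z))%:R :> R.
    rewrite indicE; congr (nat_of_bool _)%:R.
    by apply/idP/idP => [/set_mem|/mem_set].
  rewrite !indE addnC nE.
  have [xE|] := eqVneq (P (iter (h j + i) T x)) (P (iter i T y)).
    by rewrite xE [in leLHS]eq_sym add0r.
  by move=> _; rewrite -[leLHS]addr0 lerD//; case: (_ != _).
by rewrite volE// lee_fin; move: volgood; rewrite vol_setC//; lra.
Qed.

Lemma rigid_displaced (n : nat -> nat) :
  (forall A, measurable A -> mu (moved T A (n k)) @[k --> \oo] --> 0%E) ->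
  forall (r : nat) (P : X -> 'I_r) (e : R), measurable_partition P -> 0 < e ->
    \forall k \near \oo, vol mu (displaced T P (n k)) <= e.
Proof.
move=> nA r P e mP e0.
have er : 0 < e / r.+1%:R by rewrite divr_gt0.
have : \forall k \near \oo, forall i : 'I_r,
    vol mu (moved T (P @^-1` [set i]) (n k)) <= e / r.+1%:R.
  apply: filter_forall => i.
  by have /(rigid_alongP hT n (mP i))[_] := nA _ (mP i); exact.
apply: filterS => k small.
have mM (i : 'I_r) : measurable (moved T (P @^-1` [set i]) (n k)).
  exact: (measurable_moved hT).
apply: (@le_trans _ _
    (vol mu (\big[setU/set0]_(i < r) moved T (P @^-1` [set i]) (n k)))).
  apply: le_vol; first exact: (measurable_displaced hT).
    exact: bigsetU_measurable.
  move=> x /eqP Px; rewrite -bigcup_seq; exists (P x).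
    by rewrite /= mem_index_enum.
  by right; split.
apply: le_trans (vol_bigsetU _ _ _) _ => //.
apply: (@le_trans _ _ (\sum_(i < r) e / r.+1%:R)); first exact: ler_sum.
rewrite sumr_const card_ord -[leLHS]mulr_natr -[leLHS]mulrA ger_pMr//.
by rewrite mulrC ler_pdivrMr// mul1r ler_nat.
Qed.

(** The [N]-th set uses intervals of length [N + 1] and rigidity times of index
    at least [N + 1].  The cover has [r ^ (N + 1)] sets, at most
    [(N + 1) ^ (N + 1)] once [r <= N + 1], so a number of translates chosen from
    [U] alone suffices for all partitions. *)
Lemma rigid_slow_entropy0 (U : nat -> R) : rigid mu T -> rate_function U ->
  exists F : nat -> {fset nat}, folner R F /\ slow_entropy mu T U F = 0%E.
Proof.
move=> [n [n0 nS nA]] [U0 _ Uoo].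
have /choice[M MP] : forall N : nat, exists M, (0 < M)%N /\
    (N.+1 * N.+1 ^ N.+1)%:R <= U (N.+1 * M)%N.
  move=> N; have /cvgryPge/(_ (N.+1 * N.+1 ^ N.+1)%:R)[K _ KU] := Uoo.
  by exists K.+1; split => //; apply: KU; rewrite /=; lia.
pose h N j := n (N.+1 * j.+1)%N.
have nD a b : (n a + b <= n (a + b))%N.
  elim: b => [|b IH]; first by rewrite !addn0.
  by rewrite !addnS; apply: leq_ltn_trans IH (nS _).
have gap N j : (h N j + N.+1 <= h N j.+1)%N.
  by rewrite /h (mulnSr _ j.+1); exact: nD.
exists (fun N => block N.+1 (M N) (h N)); split.
  by apply: folner_block => // N; have [] := MP N.
apply: coverable_slow_entropy0; first exact: nearW.
move=> r P e c mP e0 c0.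
have ee0 : 0 < e * e / 2 by rewrite divr_gt0 // mulr_gt0.
have [K _ KP] := rigid_displaced nA mP ee0.
have [M0 _] := all_and2 MP.
near=> N; exists (r ^ N.+1)%N; split.
  apply: coverable_block => // j jM; apply: KP => /=.
  apply: (@leq_trans N.+1); last by rewrite leq_pmulr.
  by rewrite leqW//; near: N; exists K.
rewrite card_block//; have [_ UN] := MP N.
apply: le_trans (_ : c * (N.+1 * N.+1 ^ N.+1)%:R <= _); last first.
  by rewrite ler_pM2l.
rewrite natrM mulrA; apply: (@le_trans _ _ (N.+1 ^ N.+1)%:R).
  by rewrite ler_nat leq_exp2r// leqW//; near: N; exists r.
rewrite ler_peMl// -ler_pdivrMl// mulr1.
apply: (@le_trans _ _ N%:R); last by rewrite ler_nat.
by near: N; exact: nbhs_infty_ger.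
Unshelve. all: by end_near. Qed.

(** [ln (max n 2)] is positive and agrees with [ln n] for [n >= 2]. *)
Lemma rate_log_slow_entropy0 :
  (forall U : nat -> R, rate_function U ->
     exists F : nat -> {fset nat}, folner R F /\ slow_entropy mu T U F = 0%E) ->
  exists F : nat -> {fset nat},
    folner R F /\ slow_entropy mu T (log_rate R) F = 0%E.
Proof.
move=> rates.
pose U n : R := ln (maxn n 2)%:R.
have U0 n : 0 < U n by rewrite ln_gt0// ltr1n; lia.
have rU : rate_function U.
  split => // [m n mn|].
    by rewrite ler_ln ?posrE ?ltr0n ?ler_nat; lia.
  apply/cvgryPge => A; near=> n.
  rewrite -[A]expRK ler_ln ?posrE ?expR_gt0 ?ltr0n//; last by lia.
  apply: (@le_trans _ _ n%:R); last by rewrite ler_nat leq_maxl.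
  by near: n; exact: nbhs_infty_ger.
have [F [fF h0]] := rates U rU.
exists F; split; first exact: fF.
have logE : \forall n \near \oo, U #|` F n| = log_rate R #|` F n|.
  by apply: filterS (folner_card 1 fF) => n n1; rewrite /U (maxn_idPl n1).
apply: coverable_slow_entropy0.
  by apply: filterS logE => n <-.
move=> r P e c mP e0 c0.
have Upos : \forall n \near \oo, 0 < U #|` F n| by exact: nearW.
apply: filterS2 logE (slow_entropy0_coverable h0 mP e0 c0 Upos).
by move=> n <- [M [covM ltM]]; exists M; split => //; exact: ltW.
Unshelve. all: by end_near. Qed.

End Forward.

Theorem theorem4p13 (R : realType) (d : measure_display) (X : measurableType d)
    (mu : probability X R) (T : X -> X)
    (hX : standard_probability_space mu)
    (hT : invertible_measure_preserving mu T) :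
  [<-> rigid mu T;
       forall U : nat -> R, rate_function U ->
         exists F : nat -> {fset nat},
           folner R F /\ slow_entropy mu T U F = 0%E;
       exists F : nat -> {fset nat},
         folner R F /\ slow_entropy mu T (log_rate R) F = 0%E].
Proof.
tfae.
- by move=> rT U; exact: rigid_slow_entropy0.
- exact: rate_log_slow_entropy0.
- move=> [F [fF h0]]; apply: recurrent_rigid => //.
  exact: log_entropy0_recurrent h0.
Qed.
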